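(* Let $\Sigma$ be a compact Riemann surface of genus $g\geq 2$ with an anti-holomorphic involution $f$, and let $(E,\Phi)$ be a stable $SL(2,\mathbb{C})$-Higgs bundle on $\Sigma$ whose isomorphism class is fixed by the induced action of $f$. Let $\phi:E\to E$ be a holomorphic anti-linear isomorphism covering $f$ such that $\phi^{-1}\circ\Phi\circ\phi=-\Phi$, normalised (by rescaling by a positive constant) so that $\phi^2=\lambda$ with $\lambda\in\mathbb{C}^*$ constant of norm $1$. Then $\lambda=\pm1$.
   Context: An $SL(2,\mathbb{C})$-Higgs bundle is a pair $(E,\Phi)$ with $E$ a rank $2$ holomorphic vector bundle with trivial determinant and $\Phi$ a trace-free holomorphic section of $\mathrm{End}(E)\otimes K$, $K$ the canonical bundle of $\Sigma$. The induced action of $f$ on isomorphism classes is $(E,\Phi)\mapsto(f^*(\overline{E}^* ),f^*(\overline{\Phi^t}))$. An anti-linear bundle isomorphism $\phi:E\to F$ covering $f$ maps $E_x\to F_{f(x)}$ and extends to form-valued sections by $\phi(\omega\otimes s)=f^*(\overline{\omega})\otimes\phi(s)$; it is called holomorphic if $\phi\circ\overline{\partial}_E=\overline{\partial}_F\circ\phi$, i.e. it takes holomorphic sections to holomorphic sections. For $(E,\Phi)$ fixed by $f$ and stable, such a $\phi:E\to E$ with $\phi^{-1}\circ\Phi\circ\phi=-\Phi$ exists, and $\phi^2$ is a constant multiple of the identity. *)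

(* Defs.v *)
From HB Require Import structures.
From mathcomp Require Import all_boot all_order all_algebra.
From mathcomp Require Import all_classical all_reals all_analysis.
From mathcomp.real_closed Require Import complex.
Import Order.TTheory GRing.Theory Num.Theory numFieldNormedType.Exports.

Set Implicit Arguments.
Unset Strict Implicit.
Unset Printing Implicit Defensive.

Local Open Scope classical_set_scope.
Local Open Scope ring_scope.

Lemma derivable1_comp (K : numFieldType) (h k : K -> K) (z : K) :
  derivable h z 1 -> derivable k (h z) 1 ->
  derivable (k \o h) z 1 /\ derive1 (k \o h) z = derive1 k (h z) * derive1 h z.
Proof.
move=> /derivable1_diffP dh /derivable1_diffP dk.
have dkh : differentiable (k \o h) z by exact/differentiable_comp.
split; first by apply/derivable1_diffP.
have E0 := derive1E' dkh.
have E1 := derive1E' dh.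
have E2 := congr1 (fun F => F 1) (diff_comp dh dk).
have E3 := congr1 (fun F => F (derive1 h z)) (diff1E dk).
apply: (etrans E0); apply: (etrans E2).
by rewrite mulrC; apply: etrans E3; rewrite [LHS]/= E1.
Qed.

(* K = C below; C gets its topology and its normed-space structure over itself
   through the alias C^o. *)
Section Derivative.
Context {K : numFieldType}.

Definition cderivable (h : K -> K) (z : K) : Prop :=
  derivable (h : K^o -> K^o) z 1.

Definition cderiv (h : K -> K) (z : K) : K := derive1 (h : K^o -> K^o) z.

Lemma cderivable_comp (h k : K -> K) (z : K) :
  cderivable h z -> cderivable k (h z) ->
  cderivable (k \o h) z /\ cderiv (k \o h) z = cderiv k (h z) * cderiv h z.
Proof. exact: derivable1_comp. Qed.

Lemma near_cderivable (h k : K -> K) (z : K) :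
  (\forall t \near (z : K^o), h t = k t) -> cderivable h z -> cderivable k z.
Proof. exact: near_eq_derivable. Qed.

Lemma near_cderiv (h k : K -> K) (z : K) :
  (\forall t \near (z : K^o), h t = k t) -> cderiv h z = cderiv k z.
Proof. by move=> hk; rewrite /cderiv !derive1E; exact: near_eq_derive. Qed.

Lemma cderivableP (k : K -> K) (z : K) : cderivable k z <->
  (h^-1 * (k (h + z) - k z) : K^o) @[h --> (0 : K^o)^'] --> (cderiv k z : K^o).
Proof.
rewrite /cderivable /derivable /cderiv /derive1.
set g := (fun h : K^o => _); set g' := (X in _ <-> X @ _ --> _).
have -> : g = g' by apply/funext => h; rewrite /g /= [h%:A]mulr1.
by [].
Qed.

Lemma cderivE (k : K -> K) (z l : K) :
  (h^-1 * (k (h + z) - k z) : K^o) @[h --> (0 : K^o)^'] --> (l : K^o) ->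
  cderiv k z = l.
Proof. by move=> H; apply: cvg_lim H; exact: norm_hausdorff. Qed.

Lemma cderiv_id (z : K) : cderiv id z = 1.
Proof. by rewrite /cderiv derive1E; exact: derive_id. Qed.

End Derivative.

Section ConjDerivative.
Context {K : numClosedFieldType}.

Lemma cvg_conj_quotient (k : K -> K) (z l : K) :
  (h^-1 * (k (h + z^*) - k z^*) : K^o) @[h --> (0 : K^o)^'] --> (l : K^o) ->
  (h^-1 * ((k (h + z)^* )^* - (k z^* )^* ) : K^o) @[h --> (0 : K^o)^'] -->
    (l^* : K^o).
Proof.
move=> H.
have conj0 : (Num.conj : K^o -> K^o) @ (0 : K^o)^' --> (0 : K^o)^'.
  move=> A; rewrite /nbhs /= => -[e e0 eA]; exists e => // t /= te t0.
  apply: eA => /=; last by rewrite conjC_eq0.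
  by move: te; rewrite !sub0r !normrN norm_conjC.
have conjl : (Num.conj : K^o -> K^o) @ (l : K^o) --> (l^* : K^o).
  move=> A; rewrite /nbhs /= => -[e e0 eA]; exists e => // t /= te.
  by apply: eA => /=; rewrite -rmorphB norm_conjC.
have := cvg_comp _ _ (cvg_comp _ _ conj0 H) conjl.
apply: cvg_trans; apply: near_eq_cvg; exists 1; first exact: ltr01.
move=> h _ h0 /=.
by rewrite rmorphM fmorphV rmorphB /= conjCK rmorphD.
Qed.

Lemma cderivable_conj (k : K -> K) (z : K) : cderivable k z^* ->
  cderivable (Num.conj \o k \o Num.conj) z /\
  cderiv (Num.conj \o k \o Num.conj) z = (cderiv k z^* )^*.
Proof.
move=> /cderivableP /cvg_conj_quotient H.
have D : cderiv (Num.conj \o k \o Num.conj) z = (cderiv k z^* )^*.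
  exact: cderivE H.
by split => //; apply/cderivableP; rewrite D; exact: H.
Qed.

End ConjDerivative.

(* A Riemann surface: a nonempty connected Hausdorff space with an atlas of
   complex charts [coord i : cdom i -> C] with inverses [param i], and
   holomorphic transition functions. Only the values of [coord i] on [cdom i]
   and of [param i] on the image of [cdom i] are meaningful. The choice
   [chart_at] of a chart around each point carries no information: at a point
   x it identifies the tangent and cotangent lines with C. *)
Record riemann_surface (R : realType) := RiemannSurface {
  points :> topologicalType;
  atlas : Type;
  cdom : atlas -> set points;
  coord : atlas -> points -> R[i];
  param : atlas -> R[i] -> points;
  chart_at : points -> atlas;
  cdom_open : forall i, open (cdom i);
  mem_chart_at : forall x, cdom (chart_at x) x;
  coordK : forall i x, cdom i x -> param i (coord i x) = x;
  coord_image_open : forall i, open (coord i @` cdom i : set R[i]^o);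
  coord_continuous : forall i x, cdom i x ->
    {for x, continuous (coord i : points -> R[i]^o)};
  param_continuous : forall i x, cdom i x ->
    {for coord i x, continuous (param i : R[i]^o -> points)};
  transition_holo : forall i j x, cdom i x -> cdom j x ->
    cderivable (coord j \o param i) (coord i x);
  points_hausdorff : hausdorff_space points;
  points_connected : connected [set: points];
  points_nonempty : [set: points] !=set0 }.

Section RiemannSurface.
Context {R : realType} {X : riemann_surface R}.
Local Notation C := R[i].

(* Only used on open sets, where it amounts to holomorphy. *)
Definition holo_on (A : set X) (h : X -> C) : Prop :=
  forall x i, A x -> cdom i x -> cderivable (h \o param i) (coord i x).

(* The derivative dz_j/dz_i at x of one coordinate with respect to another. *)
Definition dcoord (i j : atlas X) (x : X) : C :=
  cderiv (coord j \o param i) (coord i x).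

(* A section w of the canonical bundle K is given by the coefficients w x of
   dz at x, for z the coordinate [chart_at x]; in a fixed chart z_i the section
   reads (dz/dz_i) w dz_i. *)
Definition holo_form (w : X -> C) : Prop :=
  forall i, holo_on (cdom i) (fun x => dcoord i (chart_at x) x * w x).

(* g = dim H^0(X, K). *)
Definition has_genus (g : nat) : Prop :=
  exists b : 'I_g -> X -> C,
    (forall k, holo_form (b k)) /\
    forall w, holo_form w ->
      exists! c : 'rV[C]_g, forall x, w x = \sum_k c 0 k * b k x.

(* h is meromorphic at x of order k: in the coordinate t at x, with value z at
   x, h = (t - z)^k u(t) on a punctured neighbourhood, with u holomorphic and
   nonzero at z. *)
Definition has_order (h : X -> C) (x : X) (k : int) : Prop :=
  let i := chart_at x in let z := coord i x in
  exists u : C -> C,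
    [/\ \forall t \near (z : C^o), cderivable u t,
        u z != 0 &
        \forall t \near (z : C^o)^', h (param i t) = (t - z) ^ k * u t].

End RiemannSurface.

Arguments has_genus {R} X g.

Record antiholo_involution (R : realType) (X : riemann_surface R) :=
  AntiholoInvolution {
  inv_fun :> X -> X;
  inv_involutive : involutive inv_fun;
  inv_continuous : continuous inv_fun;
  inv_antiholo : forall j,
    holo_on (inv_fun @^-1` cdom j) (Num.conj \o coord j \o inv_fun) }.

(* At y, with z and w the coordinates chosen at y and at f y, this is the
   coefficient of dz in the form f^*(conj dw), i.e. the derivative of
   conj (w o f) with respect to z. *)
Definition dconj {R : realType} {X : riemann_surface R}
    (f : antiholo_involution X) (y : X) : R[i] :=
  cderiv (Num.conj \o coord (chart_at (f y)) \o f \o param (chart_at y))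
         (coord (chart_at y) y).

(* Holomorphic vector bundles of rank n: a family of vector spaces with local
   trivialisations [triv a x] : fib x ~ C^n for x in the open set [tdom a],
   with inverse [frame a x], and holomorphic transition matrices. *)
Record holo_bundle (R : realType) (X : riemann_surface R) (n : nat) :=
  HoloBundle {
  fib :> X -> lmodType R[i];
  tidx : Type;
  tdom : tidx -> set X;
  triv : forall (a : tidx) (x : X), {linear fib x -> 'cV[R[i]]_n};
  frame : forall (a : tidx) (x : X), 'cV[R[i]]_n -> fib x;
  tdom_open : forall a, open (tdom a);
  tdom_cover : forall x, exists a, tdom a x;
  trivK : forall a x, tdom a x -> cancel (triv a x) (frame a x);
  frameK : forall a x, tdom a x -> cancel (frame a x) (triv a x);
  triv_holo : forall a b (i j : 'I_n), holo_on (tdom a `&` tdom b)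
    (fun x => triv b x (frame a x (delta_mx j 0)) i 0) }.

Section Bundles.
Context {R : realType} {X : riemann_surface R}.
Local Notation C := R[i].

Definition trans_mx {n} (E : holo_bundle X n) (a b : tidx E) (x : X) :
    'M[C]_n :=
  \matrix_(i, j) triv b x (frame a x (delta_mx j 0)) i 0.

Definition end_mx {n} (E : holo_bundle X n) (a : tidx E) (x : X)
    (T : E x -> E x) : 'M[C]_n :=
  \matrix_(i, j) triv a x (T (frame a x (delta_mx j 0))) i 0.

Definition holo_section {n} (E : holo_bundle X n) (U : set X)
    (s : forall x, E x) : Prop :=
  forall (a : tidx E) (i : 'I_n),
    holo_on (U `&` tdom a) (fun x => triv a x (s x) i 0).

Definition holo_hom {m n} (E : holo_bundle X m) (F : holo_bundle X n)
    (psi : forall x, {linear E x -> F x}) : Prop :=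
  forall (U : set X) (s : forall x, E x), open U ->
    holo_section U s -> holo_section U (fun x => psi x (s x)).

(* s lists the coordinates, in the frames induced by the trivialisations of E,
   of a section of the determinant line bundle of E. *)
Definition det_section {n} (E : holo_bundle X n) (s : tidx E -> X -> C) :
    Prop :=
  forall a b x, tdom a x -> tdom b x -> s b x = \det (trans_mx a b x) * s a x.

Definition trivial_det {n} (E : holo_bundle X n) : Prop :=
  exists s : tidx E -> X -> C,
    [/\ det_section s, forall a, holo_on (tdom a) (s a) &
        forall a x, tdom a x -> s a x != 0].

(* deg E = deg (det E) is the degree of the divisor D of a nonzero meromorphic
   section of det E (of det E = E itself for a line bundle). *)
Definition has_degree {n} (E : holo_bundle X n) (d : int) : Prop :=
  exists (s : tidx E -> X -> C) (D : X -> int),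
    [/\ det_section s,
        forall a x, tdom a x -> has_order (s a) x (D x),
        finite_set [set x | D x != 0] &
        d = \sum_(x \in [set: X]) D x].

(* Sections of End(E) (x) K; as for forms, [P x] is the coefficient of dz for z
   the coordinate [chart_at x]. *)
Definition end_form {n} (E : holo_bundle X n) : Type :=
  forall x, {linear E x -> E x}.

Definition holo_end_form {n} (E : holo_bundle X n) (P : end_form E) : Prop :=
  forall (i : atlas X) (a : tidx E) k l, holo_on (cdom i `&` tdom a)
    (fun x => dcoord i (chart_at x) x * end_mx a (P x) k l).

Definition higgs_isomorphic {n} (E : holo_bundle X n) (P : end_form E)
    (F : holo_bundle X n) (Q : end_form F) : Prop :=
  exists psi : forall x, {linear E x -> F x},
    [/\ holo_hom psi, forall x, bijective (psi x) &
        forall x v, psi x (P x v) = Q x (psi x v)].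

End Bundles.

Record sl2_higgs_bundle (R : realType) (X : riemann_surface R) :=
  SL2HiggsBundle {
  higgs_bundle :> holo_bundle X 2;
  higgs_det : trivial_det higgs_bundle;
  higgs_field : end_form higgs_bundle;
  higgs_holo : holo_end_form higgs_field;
  higgs_traceless : forall a x, tdom a x ->
    \tr (end_mx a (higgs_field x)) = 0 }.

(* Every holomorphic line subbundle L of E invariant under the Higgs field
   satisfies deg L / 1 < deg E / 2. *)
Definition stable {R : realType} {X : riemann_surface R}
    (E : sl2_higgs_bundle X) : Prop :=
  forall (L : holo_bundle X 1) (j : forall x, {linear L x -> E x}),
    holo_hom j -> (forall x, injective (j x)) ->
    (forall x (l : L x), exists m : L x, higgs_field E x (j x l) = j x m) ->
    forall dL dE : int, has_degree L dL -> has_degree E dE -> dL * 2 < dE.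

Section ConjDual.
Context {R : realType}.
Local Notation C := R[i].
Variable V : lmodType C.

(* conj(V)^*, the space of anti-linear functionals on V, with pointwise
   operations. *)
Definition antilinear_functional : {pred V -> C^o} :=
  [pred u : V -> C^o |
    `[< forall (a : C) (v w : V), u (a *: v + w) = a^* * u v + u w >]].

Fact antilinear_functional_submod : submod_closed antilinear_functional.
Proof.
split=> [|c u u' /asboolW hu /asboolW hu']; apply: asboolT => a v w.
  by rewrite (_ : forall v, (0 : V -> C^o) v = 0) // mulr0 addr0.
rewrite !fctE hu hu' /GRing.scale /= !mulrDr addrACA.
by rewrite [c * _]mulrCA.
Qed.

HB.instance Definition _ := GRing.isSubmodClosed.Build C (V -> C^o)
  antilinear_functional antilinear_functional_submod.

Record conj_dual := ConjDual {
  conj_dual_val :> V -> C^o;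
  _ : conj_dual_val \in antilinear_functional }.

HB.instance Definition _ := [isSub for conj_dual_val].
HB.instance Definition _ := [Choice of conj_dual by <:].
HB.instance Definition _ :=
  [SubChoice_isSubLmodule of conj_dual by <:].

End ConjDual.

Section ConjCalculus.
Context {R : realType}.
Local Notation C := R[i].
Context {X : riemann_surface R} (f : antiholo_involution X).

Lemma near_param_inv (x : X) (i : atlas X) (A : set X) :
  cdom i x -> open A -> A (f x) ->
  \forall t \near (coord i x : C^o), A (f (param i t)).
Proof.
move=> ix oA Afx.
have fA : nbhs (f (param i (coord i x))) A.
  by rewrite coordK //; exact: open_nbhs_nbhs.
exact: (param_continuous ix (inv_continuous fA)).
Qed.

Lemma holo_conj_pullback (U : set X) (h : X -> C) :
  holo_on U h -> holo_on (f @^-1` U) (Num.conj \o h \o f).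
Proof.
move=> hU x i Ux ix; pose j := chart_at (f x).
have jx : cdom j (f x) by exact: mem_chart_at.
have G := @inv_antiholo _ _ f j _ _ jx ix.
have Gx : ((Num.conj \o coord j \o f) \o param i) (coord i x) =
          (coord j (f x))^*.
  by rewrite /= coordK.
have H : cderivable (h \o param j)
    (((Num.conj \o coord j \o f) \o param i) (coord i x))^*.
  by rewrite Gx conjCK; exact: hU.
have [D _] := cderivable_comp G (proj1 (cderivable_conj H)).
apply: near_cderivable D.
apply: filterS (near_param_inv ix (cdom_open j) jx) => t /= jt.
by rewrite conjCK coordK.
Qed.

Lemma dconj_conj (x : X) : dconj f x * (dconj f (f x))^* = 1.
Proof.
rewrite {2}/dconj inv_involutive.
set i := chart_at x; set j := chart_at (f x).
have jx : cdom j (f x) by exact: mem_chart_at.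
have ix : cdom i x by exact: mem_chart_at.
have ix' : cdom i (f (f x)) by rewrite inv_involutive.
have G := @inv_antiholo _ _ f j _ _ jx ix.
have G2 := @inv_antiholo _ _ f i _ _ ix' jx.
have Gx : ((Num.conj \o coord j \o f) \o param i) (coord i x) =
          (coord j (f x))^*.
  by rewrite /= coordK.
pose k : C -> C := Num.conj \o coord i \o f \o param j.
have [D2 E2] : cderivable (Num.conj \o k \o Num.conj) (coord j (f x))^* /\
    cderiv (Num.conj \o k \o Num.conj) (coord j (f x))^* =
    (cderiv k (coord j (f x)))^*.
  have := @cderivable_conj C k (coord j (f x))^*.
  by rewrite conjCK; apply.
rewrite -Gx in D2 E2.
have [_] := cderivable_comp G D2.
rewrite E2 mulrC => <-.
rewrite (_ : 1 = cderiv id (coord i x)); last by rewrite cderiv_id.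
apply: near_cderiv.
have ti : \forall t \near (coord i x : C^o), (coord i @` cdom i) t.
  by apply: open_nbhs_nbhs; split; [exact: coord_image_open | exists x].
apply: filterS2 ti (near_param_inv ix (cdom_open j) jx) => t [y iy <-] /=.
rewrite !conjCK coordK // => jy.
by rewrite coordK // inv_involutive.
Qed.

End ConjCalculus.

Section ConjDualPullback.
Context {R : realType} {X : riemann_surface R} (f : antiholo_involution X).
Local Notation C := R[i].

Lemma conj_dual_inj (V : lmodType C) (u u' : conj_dual V) :
  (forall v, u v = u' v) -> u = u'.
Proof. by move=> uu'; apply: val_inj; apply/funext. Qed.

Lemma conj_dualP (V : lmodType C) (u : conj_dual V) (a : C) (v w : V) :
  u (a *: v + w) = a^* * u v + u w.
Proof. by case: u => u /= /asboolW; apply. Qed.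

Lemma conj_dual_sum (V : lmodType C) (u : conj_dual V) n (c : 'I_n -> C)
    (e : 'I_n -> V) :
  u (\sum_i c i *: e i) = \sum_i (c i)^* * u (e i).
Proof.
have u0 : u 0 = 0.
  have := conj_dualP u 1 0 0.
  rewrite scaler0 addr0 conjC1 mul1r => /eqP.
  by rewrite -subr_eq0 opprD addNKr oppr_eq0 => /eqP.
elim: n c e => [|n IH] c e; first by rewrite !big_ord0 u0.
by rewrite !big_ord_recl conj_dualP IH.
Qed.

Section Fibre.
Context {n : nat} (E : holo_bundle X n).

Definition cd_triv (a : tidx E) (x : X) (u : conj_dual (E (f x))) : 'cV[C]_n :=
  \col_i u (frame a (f x) (delta_mx i 0)).

Fact cd_triv_linear a x : linear (@cd_triv a x).
Proof. by move=> c u u'; apply/colP => i; rewrite !mxE. Qed.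

HB.instance Definition _ a x :=
  GRing.isLinear.Build C (conj_dual (E (f x))) 'cV[C]_n *:%R (@cd_triv a x)
    (@cd_triv_linear a x).

Fact cd_frame_subproof (a : tidx E) (x : X) (w : 'cV[C]_n) :
  ((fun v : E (f x) => \sum_i (triv a (f x) v i 0)^* * w i 0) : _ -> C^o)
    \in @antilinear_functional R (E (f x)).
Proof.
apply: asboolT => c v v' /=; rewrite mulr_sumr -big_split.
apply: eq_bigr => i _.
by rewrite linearP !mxE rmorphD rmorphM mulrDl mulrA.
Qed.

Definition cd_frame (a : tidx E) (x : X) (w : 'cV[C]_n) : conj_dual (E (f x)) :=
  ConjDual (cd_frame_subproof a x w).

Lemma frame_sum (a : tidx E) (x : X) (v : E x) : tdom a x ->
  v = \sum_i triv a x v i 0 *: frame a x (delta_mx i 0).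
Proof.
move=> ax; apply: (can_inj (trivK ax)); rewrite raddf_sum /=.
rewrite (eq_bigr (fun i => triv a x v i 0 *: delta_mx i 0)); last first.
  by move=> i _; rewrite linearZ /= frameK.
rewrite {1}[triv a x v]matrix_sum_delta.
by apply: eq_bigr => i _; rewrite big_ord1.
Qed.

Lemma cd_trivK a x : tdom a (f x) -> cancel (@cd_triv a x) (@cd_frame a x).
Proof.
move=> ax u; apply: conj_dual_inj => v /=.
rewrite [in RHS](frame_sum v ax) conj_dual_sum.
by apply: eq_bigr => i _; rewrite !mxE.
Qed.

Lemma cd_frameK a x : tdom a (f x) -> cancel (@cd_frame a x) (@cd_triv a x).
Proof.
move=> ax w; apply/colP => i; rewrite !mxE /= frameK // (bigD1 i) //= !mxE.
rewrite !eqxx conjC1 mul1r big1 ?addr0 // => j ji.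
by rewrite !mxE (negbTE ji) conjC0 mul0r.
Qed.

Lemma cd_tdom_open (a : tidx E) : open (f @^-1` tdom a).
Proof. by apply: open_comp (tdom_open a) => y _; exact: inv_continuous. Qed.

Lemma cd_triv_holo (a b : tidx E) (i j : 'I_n) :
  holo_on (f @^-1` tdom a `&` f @^-1` tdom b)
    (fun x => cd_triv b (cd_frame a x (delta_mx j 0)) i 0).
Proof.
have := holo_conj_pullback (f := f) (@triv_holo _ _ _ E b a j i).
rewrite preimage_setI setIC.
set g := (X in holo_on _ X -> _); set g' := (X in _ -> holo_on _ X).
suff -> : g = g' by [].
apply/funext => x; rewrite /g /g' mxE /= (bigD1 j) //= big1 => [|k kj].
  by rewrite !mxE !eqxx mulr1 addr0.
by rewrite !mxE (negbTE kj) mulr0.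
Qed.

(* The bundle f^*(conj(E)^* ), with fibre conj(E_(f x))^* at x, trivialised over
   the preimage of [tdom a] by the frame dual to the conjugate of [frame a]. *)
Definition conj_dual_pullback : holo_bundle X n :=
  @HoloBundle R X n (fun x => conj_dual (E (f x))) (tidx E)
    (fun a => f @^-1` tdom a) (fun a x => @cd_triv a x : {linear _ -> _})
    cd_frame cd_tdom_open (fun x => tdom_cover E (f x)) cd_trivK cd_frameK
    cd_triv_holo.

Section Field.
Variable P : end_form E.

Fact cd_end_subproof (x : X) (u : conj_dual (E (f x))) :
  ((fun v : E (f x) => dconj f x * u (P (f x) v)) : _ -> C^o)
    \in @antilinear_functional R (E (f x)).
Proof.
by apply: asboolT => c v w /=; rewrite linearP conj_dualP mulrDr mulrCA.
Qed.

(* f^*(conj(P)^t): the transpose of conj(P) acts on anti-linear functionals by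
   precomposition with P, and [dconj f x] is the coefficient of the pulled-back
   conjugate coordinate differential. *)
Definition cd_end (x : X) (u : conj_dual (E (f x))) : conj_dual (E (f x)) :=
  ConjDual (cd_end_subproof u).

Fact cd_end_linear x : linear (@cd_end x).
Proof.
move=> c u u'; apply: conj_dual_inj => v /=.
by rewrite /= mulrDr; congr (_ + _); rewrite mulrCA.
Qed.

HB.instance Definition _ x :=
  GRing.isLinear.Build C (conj_dual (E (f x))) (conj_dual (E (f x))) *:%R
    (@cd_end x) (@cd_end_linear x).

Definition conj_dual_pullback_end : end_form conj_dual_pullback :=
  fun x => @cd_end x : {linear _ -> _}.

End Field.
End Fibre.
End ConjDualPullback.

Section AntilinearIsomorphisms.
Context {R : realType} {X : riemann_surface R} (f : antiholo_involution X).
Context {n : nat}.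

(* Anti-linear bundle isomorphisms E -> F covering f. *)
Record antilinear_iso (E F : holo_bundle X n) := AntilinearIso {
  amap :> forall x, {linear E x -> F (f x) | Num.conj \; *:%R};
  ainv : forall x, F (f x) -> E x;
  amapK : forall x, cancel (amap x) (@ainv x);
  ainvK : forall x, cancel (@ainv x) (amap x) }.

Context {E F : holo_bundle X n} (phi : antilinear_iso E F).

(* phi takes a section s over U to the section t over f(U) with
   t (f x) = phi (s x). *)
Definition holo_antilinear : Prop :=
  forall (U : set X) (s : forall x, E x) (t : forall y, F y),
    open U -> holo_section U s -> (forall x, U x -> t (f x) = phi x (s x)) ->
    holo_section (f @` U) t.

(* The extension w (x) s |-> f^*(conj w) (x) phi(s) of phi to E (x) K and of
   its inverse, which covers f^-1 = f, from F (x) K to E (x) K. Elements of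
   E (x) K over x are identified with their coefficients in E x of dz, for z
   the coordinate [chart_at x]. *)
Definition amap_form (x : X) (v : E x) : F (f x) :=
  dconj f (f x) *: phi x v.

Definition ainv_form (x : X) (w : F (f x)) : E x :=
  dconj f x *: ainv phi w.

Lemma amap_formK x : cancel (@amap_form x) (@ainv_form x).
Proof.
move=> v; apply: (can_inj (amapK phi (x := x))).
rewrite linearZ /= ainvK scalerA -[RHS]scale1r; congr (_ *: _).
by rewrite -(dconj_conj f (f x)) inv_involutive mulrC.
Qed.

Lemma ainv_formK x : cancel (@ainv_form x) (@amap_form x).
Proof.
move=> w; rewrite /amap_form /ainv_form linearZ /= ainvK scalerA.
have /= := dconj_conj f (f x).
by rewrite inv_involutive => ->; rewrite scale1r.
Qed.

End AntilinearIsomorphisms.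

(* The total space of E is the sigma type; comparing points there avoids
   transporting between the fibres over f (f x) and over x. *)
Definition total_point {R : realType} {X : riemann_surface R} {n : nat}
    (E : holo_bundle X n) (x : X) (v : E x) : {x : X & E x} := existT _ x v.

(* (E, P) is isomorphic to (f^*(conj(E)^* ), f^*(conj(P)^t)), as Higgs bundles;
   the target need not be shown to be an SL(2)-Higgs bundle, since being one is
   invariant under isomorphism. *)
Definition fixed_class {R : realType} {X : riemann_surface R}
    (f : antiholo_involution X) (E : sl2_higgs_bundle X) : Prop :=
  higgs_isomorphic (higgs_field E)
    (conj_dual_pullback_end f (higgs_field E)).

(* Main.v *)
Require Import Defs.
From mathcomp Require Import all_boot all_order all_algebra.
From mathcomp Require Import all_classical all_reals all_analysis.
From mathcomp.real_closed Require Import complex.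
Import Order.TTheory GRing.Theory Num.Theory numFieldNormedType.Exports.

Local Open Scope classical_set_scope.
Local Open Scope ring_scope.

(** Associativity of composition, [phi^2 o phi = phi o phi^2], is the whole
    reason: as [phi] is anti-linear, [lambda] comes out of the right-hand side
    conjugated, so [lambda *: phi v = lambda^* *: phi v] for every vector [v].
    The fibres have rank 2 and [phi] is injective, so some [phi v] is nonzero and
    [lambda] is real; a real number of norm 1 is [1] or [-1].

    The two sides of [phi^2 = lambda] live in the fibres over [f (f x)] and [x].
    Composing with [phi] is therefore done on the total space of the bundle, and
    the fibrewise equation is recovered at the end from the injectivity of the
    inclusion of a fibre in the total space. *)

Lemma total_point_inj {R : realType} {X : riemann_surface R} {n : nat}
  (E : holo_bundle X n) (x : X) : injective (@total_point R X n E x).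
Proof. by move=> v w; exact: eq_from_Tagged. Qed.

Lemma fib_neq0 {R : realType} {X : riemann_surface R} {n : nat}
  (E : holo_bundle X n.+1) (x : X) : exists v : E x, v != 0.
Proof.
have [a ax] := tdom_cover E x.
exists (frame a x (delta_mx 0 0)); apply/eqP => /(congr1 (triv a x)).
rewrite frameK // raddf0 => /matrixP/(_ 0 0).
by rewrite !mxE !eqxx => /eqP; rewrite oner_eq0.
Qed.

(** Both sides are [phi^3 v]: on the left [phi^2] is applied to [phi v], on the
    right [phi] is applied to [phi^2 v]. *)
Lemma antilinear_sqr_conj {R : realType} {X : riemann_surface R}
  {f : antiholo_involution X} {n : nat} {E : holo_bundle X n}
  {phi : antilinear_iso f E E} {lambda : R[i]}
  (phi_sqr : forall (x : X) (v : E x),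
    total_point (phi (f x) (phi x v)) = total_point (lambda *: v))
  (x : X) (v : E x) : lambda *: phi x v = lambda^* *: phi x v.
Proof.
pose total_phi (p : {x : X & E x}) := total_point (phi (projT1 p) (projT2 p)).
apply: total_point_inj; rewrite -phi_sqr.
have /= := congr1 total_phi (phi_sqr x v).
by rewrite /total_phi /= linearZ.
Qed.

Theorem proposition39 (R : realType) (X : riemann_surface R)
  (X_compact : compact [set: X])
  (g : nat) (X_genus : has_genus X g) (g_ge2 : (2 <= g)%N)
  (f : antiholo_involution X)
  (E : sl2_higgs_bundle X) (E_stable : stable E) (E_fixed : fixed_class f E)
  (phi : antilinear_iso f E E) (phi_holo : holo_antilinear phi)
  (phi_field : forall (x : X) (v : E x),
    ainv_form phi (higgs_field E (f x) (phi x v)) = - higgs_field E x v)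
  (lambda : R[i]) (lambda_neq0 : lambda != 0) (lambda_norm : `|lambda| = 1)
  (phi_sqr : forall (x : X) (v : E x),
    total_point (phi (f x) (phi x v)) = total_point (lambda *: v)) :
  lambda = 1 \/ lambda = -1.
Proof.
have [x _] := points_nonempty X.
have [v v_neq0] := fib_neq0 E x.
have phiv_neq0 : phi x v != 0.
  by apply: contra_neq v_neq0 => phiv0; apply: (can_inj (amapK phi (x := x)));
    rewrite phiv0 raddf0.
have lambda_real : lambda = lambda^*.
  apply/eqP; rewrite -subr_eq0 -[_ == 0]orbF -(negbTE phiv_neq0) -scaler_eq0.
  by rewrite scalerBl subr_eq0; apply/eqP; exact: antilinear_sqr_conj phi_sqr x v.
have : lambda ^+ 2 == 1.
  by rewrite expr2 {2}lambda_real -normCK lambda_norm expr1n.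
by rewrite sqrf_eq1 => /orP[] /eqP; [left | right].
Qed.
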